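(* Let $\Omega\subset\mathbb{R}^{16}$ be open and let $f=\sum_{j=0}^7 e_jf_j:\Omega\to\mathbb{O}_{\mathbb{C}}$, with $f_j:\Omega\to\mathbb{C}$, be twice differentiable. If $f$ is monogenic, i.e. $Df=0$ in $\Omega$, then $\mathcal{L}f_j=0$ in $\Omega$ for each $j=0,1,\dots,7$, where $\mathcal{L}=D\overline{D}=\overline{D}D=\Delta_x-\Delta_y+2i\langle\partial_x,\partial_y\rangle$.
   Context: $\mathbb{O}$ is the real octonion algebra with basis $e_0=1,e_1,\dots,e_7$: here $1,e_1,e_2,e_3=e_1e_2$ span the quaternions $\mathbb{H}$, $e_5=e_1e_4$, $e_6=e_2e_4$, $e_7=e_3e_4$, every octonion is $a+be_4$ with $a,b\in\mathbb{H}$, and the product is $(a+be_4)(c+de_4)=(ac-\overline{d}b)+(b\overline{c}+da)e_4$, where the overline is quaternionic conjugation. $\mathbb{O}_{\mathbb{C}}=\mathbb{O}\otimes\mathbb{C}$ consists of elements $z=x+iy$ with $x,y\in\mathbb{O}$; $i$ is the complex imaginary unit, commuting with all $e_j$, and the product is extended $\mathbb{C}$-bilinearly. Identify $\mathbb{R}^{16}$ with $\mathbb{O}_{\mathbb{C}}$ via the coordinates $(x_0,\dots,x_7,y_0,\dots,y_7)$ of $x=\sum_j x_je_j$, $y=\sum_j y_je_j$. With $\partial_{z_j}=\partial_{x_j}+i\partial_{y_j}$, the Cauchy–Riemann operator is $Df=\sum_{j=0}^7 e_j\,\partial_{z_j}f$ (left multiplication by $e_j$) and its conjugate is $\overline{D}f=\partial_{z_0}f-\sum_{j=1}^7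 e_j\,\partial_{z_j}f$. A continuously differentiable $f:\Omega\to\mathbb{O}_{\mathbb{C}}$ is called monogenic if $Df=0$. Here $\Delta_x=\sum_{j=0}^7\partial_{x_j}^2$, $\Delta_y=\sum_{j=0}^7\partial_{y_j}^2$, $\langle\partial_x,\partial_y\rangle=\sum_{j=0}^7\partial_{x_j}\partial_{y_j}$, so that $\mathcal{L}=\sum_{j=0}^7\partial_{z_j}^2$ acts on complex-valued functions. *)

(* Defs.v *)
From mathcomp Require Import all_boot all_order all_algebra.
From mathcomp Require Import complex.
From mathcomp Require Import boolp classical_sets reals topology normedtype derive.

Set Implicit Arguments.
Unset Strict Implicit.
Unset Printing Implicit Defensive.

Import Order.TTheory GRing.Theory Num.Theory.
Import numFieldNormedType.Exports.

Local Open Scope classical_set_scope.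
Local Open Scope ring_scope.

Section RealOctonions.
Context {R : realType}.

(* Coordinates with respect to 1, e_1, e_2, e_3 = e_1 e_2. *)
Definition qmul (a b : 'rV[R]_4) : 'rV[R]_4 :=
  \row_(j < 4) nth 0
    [:: a 0 0 * b 0 0 - a 0 1 * b 0 1 - a 0 2 * b 0 2 - a 0 3 * b 0 3;
        a 0 0 * b 0 1 + a 0 1 * b 0 0 + a 0 2 * b 0 3 - a 0 3 * b 0 2;
        a 0 0 * b 0 2 + a 0 2 * b 0 0 + a 0 3 * b 0 1 - a 0 1 * b 0 3;
        a 0 0 * b 0 3 + a 0 3 * b 0 0 + a 0 1 * b 0 2 - a 0 2 * b 0 1] j.

Definition qconj (a : 'rV[R]_4) : 'rV[R]_4 :=
  \row_(j < 4) (if j == 0 then a 0 j else - a 0 j).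

(* Coordinates with respect to e_0, ..., e_7: since e_(4+k) = e_k e_4 for
   k = 1, 2, 3, the octonion a + b e_4 is the block row (a, b). *)
Definition omul (x y : 'rV[R]_8) : 'rV[R]_8 :=
  let a := @lsubmx R 1 4 4 x in let b := @rsubmx R 1 4 4 x in
  let c := @lsubmx R 1 4 4 y in let d := @rsubmx R 1 4 4 y in
  row_mx (qmul a c - qmul (qconj d) b) (qmul b (qconj c) + qmul d a).

End RealOctonions.

Section ComplexOctonions.
Variable R : realType.

(* z 0 j is the complex coordinate x_j + i y_j. *)
Definition OC := 'rV[R[i]]_8.

Definition oce (j : 'I_8) : OC := delta_mx 0 j.

(* The C-bilinear extension of [omul]. *)
Definition ocmul (z w : OC) : OC :=
  \sum_(j < 8) \sum_(k < 8)
    (z 0 j * w 0 k) *: map_mx (fun t : R => t%:C%C)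
                         (omul (delta_mx 0 j) (delta_mx 0 k)).

(* The identification of O_C with R^16, coordinates (x_0..x_7, y_0..y_7). *)
Definition oc_coords (z : OC) : 'rV[R]_(8 + 8) :=
  row_mx (map_mx (@complex.Re R) z) (map_mx (@complex.Im R) z).

End ComplexOctonions.

Section Operators.
Context {R : realType}.
Local Notation V := 'rV[R]_(8 + 8).
Implicit Types (h : V -> R[i]) (f : V -> OC R).

Definition cderive (v : V) h : V -> R[i] := fun p =>
  ('D_v (fun q => complex.Re (h q)) p +i* 'D_v (fun q => complex.Im (h q)) p)%C.

Definition pdx (j : 'I_8) := cderive (delta_mx 0 (lshift 8 j)).
Definition pdy (j : 'I_8) := cderive (delta_mx 0 (rshift 8 j)).

(* The convention here is d_x + i d_y, without the factor 1/2. *)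
Definition pdz (j : 'I_8) h : V -> R[i] := fun p => pdx j h p + 'i%C * pdy j h p.

Definition occomp f (j : 'I_8) : V -> R[i] := fun p => f p 0 j.

Definition oc_pdz (j : 'I_8) f : V -> OC R := fun p =>
  \row_(k < 8) pdz j (occomp f k) p.

Definition CR f : V -> OC R := fun p =>
  \sum_(j < 8) ocmul (oce R j) (oc_pdz j f p).

Definition CRbar f : V -> OC R := fun p =>
  oc_pdz 0 f p - \sum_(j < 8 | j != 0) ocmul (oce R j) (oc_pdz j f p).

Definition calL h : V -> R[i] := fun p => \sum_(j < 8) pdz j (pdz j h) p.
Definition lapx h : V -> R[i] := fun p => \sum_(j < 8) pdx j (pdx j h) p.
Definition lapy h : V -> R[i] := fun p => \sum_(j < 8) pdy j (pdy j h) p.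
Definition dxdy h : V -> R[i] := fun p => \sum_(j < 8) pdx j (pdy j h) p.

Definition real_form f : V -> V := fun p => oc_coords (f p).

Definition C1_on (Omega : set V) f : Prop :=
  forall p, Omega p ->
    differentiable (real_form f) p /\ {for p, continuous (jacobian (real_form f))}.

(* Twice Frechet differentiable: the total derivative, as a matrix-valued map,
   is itself differentiable.  The second derivatives need not be continuous. *)
Definition twice_differentiable (Omega : set V) f : Prop :=
  forall p, Omega p ->
    differentiable (real_form f) p /\ differentiable (jacobian (real_form f)) p.

Definition monogenic (Omega : set V) f : Prop :=
  C1_on Omega f /\ forall p, Omega p -> CR f p = 0.

End Operators.

(* Main.v *)
Require Import Defs.
From mathcomp Require Import all_boot all_order all_algebra ring.
From mathcomp Require Import complex.
From mathcomp Require Import boolp classical_sets functions reals topology normedtype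
  landau derive.
Import Order.TTheory GRing.Theory Num.Theory.
Import numFieldNormedType.Exports.
Local Open Scope classical_set_scope.
Local Open Scope ring_scope.

Set Implicit Arguments.
Unset Strict Implicit.
Unset Printing Implicit Defensive.

(** Write the components of [CR f] and [CRbar f] through the structure constants
    c(j,k,m) of the octonions: the e_m-component of e_j e_k.  Left multiplication
    by e_0 is the identity and by e_j, j > 0, is skew, so [CRbar] has the
    transposed constants c(j,m,k).  Polarizing the norm identity
    |xy|^2 = |x|^2 |y|^2 gives
    sum_m c(j,n,m) c(k,l,m) + c(k,n,m) c(j,l,m) = 2 delta_jk delta_nl,
    and the same with all constants transposed.  Since the operators d_(z_j)
    commute on f, only the diagonal terms d_(z_j)^2 of [CR (CRbar f)] and
    [CRbar (CR f)] survive.  As f is only twice differentiable, the commutation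
    is Young's form of the symmetry theorem: it suffices that the first order
    partial derivatives are differentiable at the point. *)

(** * Symmetry of second directional derivatives *)

Section Young.
Context {R : realType} {V : normedModType R}.
Implicit Types (g : V -> R) (p u v : V).

(** The chain rule along a line, at an arbitrary parameter [s], in the form that the mean value
    theorem consumes. *)
Lemma is_derive_line g a u (s : R) : differentiable g (a + s *: u) ->
  is_derive s 1 (fun r : R => g (a + r *: u)) ('D_u g (a + s *: u)).
Proof.
move=> dg.
have dl : is_diff s (fun r : R => a + r *: u) (fun h => h *: u).
  by apply: is_diff_eq; rewrite funeqE => h; rewrite fctE add0r.
have dc : is_diff s (g \o (fun r : R => a + r *: u)) ('d g (a + s *: u) \o (fun h => h *: u)).
  exact: is_diff_comp.
have dcd : differentiable (g \o (fun r : R => a + r *: u)) s by case: dc.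
apply: DeriveDef; first exact: diff_derivable.
by rewrite deriveE// deriveE// diff_val /= scale1r.
Qed.

Definition second_difference g p u v (t : R) :=
  g (p + t *: u + t *: v) - g (p + t *: u) - g (p + t *: v) + g p.

Lemma second_differenceC g p u v t :
  second_difference g p u v t = second_difference g p v u t.
Proof. by rewrite /second_difference [p + _ + _]addrAC (addrAC (g _)). Qed.

(* By the mean value theorem applied to [s |-> g (p + s u + t v) - g (p + s u)],
   the second difference is t times an increment of ['D_u g]; only the
   differentiability of ['D_u g] at [p] itself is used. *)
Lemma second_difference_approx g p u v :
  (\forall q \near p, differentiable g q) -> differentiable ('D_u g) p ->
  forall e : R, 0 < e -> \forall t \near 0^'+,
    `|second_difference g p u v t - t ^+ 2 * 'D_v ('D_u g) p| <= e * t ^+ 2.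
Proof.
move=> gd kd e e0; set k := 'D_u g.
set N := `|u| + `|v|.
have N0 : 0 <= N by rewrite addr_ge0.
(* Two first order remainders, each at most [e' * (t * N)], are added below, which accounts for the
   2. Taking [N + 1] keeps the denominator positive when [u] and [v] both vanish. *)
pose e' := e / (2 * (N + 1)).
have e'0 : 0 < e' by rewrite divr_gt0// mulr_gt0// ltr_wpDl.
have e'N : 2 * (e' * N) <= e.
  rewrite [leRHS](_ : _ = 2 * (e' * (N + 1))).
    by rewrite !ler_pM2l// lerDl.
  by rewrite /e'; field; rewrite gt_eqF// ltr_wpDl.
have [d /= d0 gdd] : exists2 d : R, 0 < d & forall h : V, `|h| < d ->
    differentiable g (p + h) /\ `|k (p + h) - k p - 'd k p h| <= e' * `|h|.
  have /nbhs_norm0P [d1 /= d10 H1] : \forall h \near (0 : V),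
      `|k (p + h) - k p - 'd k p h| <= e' * `|h|.
    have /diff_locallyP [_ /eqaddoP /(_ _ e'0)] := kd.
    apply: filterS => h /=.
    by rewrite !fctE /= opprD addrA [p + h]addrC.
  have /nbhs_normP [d2 /= d20 H2] := gd.
  exists (Num.min d1 d2); first by rewrite lt_min d10.
  move=> h; rewrite lt_min => /andP[h1 h2]; split; last exact: H1.
  by apply: H2; rewrite /= opprD addNKr normrN.
near=> t.
have t0 : 0 < t by near: t; exact: nbhs_right_gt.
(* This keeps [p + s u] and [p + s u + t v] in the ball of radius [d] for all [s] between 0 and
   [t]. *)
have tN : t * N < d.
  have : t < d / (N + 1).
    by near: t; apply: nbhs_right_lt; rewrite divr_gt0// ltr_wpDl.
  rewrite ltr_pdivlMr ?ltr_wpDl// => /(le_lt_trans _); apply.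
  by rewrite ler_pM2l// lerDl.
have small s : 0 <= s <= t -> `|s *: u + t *: v| <= t * N /\ `|s *: u| <= t * N.
  move=> /andP[s0 st].
  have su : `|s *: u| <= t * `|u| by rewrite normrZ ger0_norm// ler_wpM2r.
  rewrite mulrDr; split; last by rewrite (le_trans su)// lerDl mulr_ge0// ltW.
  by rewrite (le_trans (ler_normD _ _))// lerD// normrZ gtr0_norm.
pose phi (s : R) := g (p + t *: v + s *: u) - g (p + s *: u).
have dphi s : 0 <= s <= t ->
  is_derive s 1 phi (k (p + t *: v + s *: u) - k (p + s *: u)).
  move=> /small [s1 s2].
  apply: is_deriveB; apply: is_derive_line.
    rewrite -addrA (addrC (t *: v)).
    by apply: (gdd _ _).1; exact: le_lt_trans tN.
  by apply: (gdd _ _).1; exact: le_lt_trans tN.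
have itvT s : s \in `]0, t[ -> 0 <= s <= t.
  by rewrite in_itv /= => /andP[s0 st]; rewrite !ltW.
have phic : {within `[0, t], continuous phi}.
  apply: derivable_within_continuous => s; rewrite in_itv /= => /dphi.
  by case.
have [c /itvT c0t] := MVT t0 (fun s st => dphi s (itvT s st)) phic.
have -> : phi t - phi 0 = second_difference g p u v t.
  by rewrite /phi /second_difference !scale0r !addr0 [p + _ + _]addrAC; ring.
rewrite subr0 => ->.
have [c1 c2] := small c c0t.
have [_ k1] := gdd _ (le_lt_trans c1 tN).
have [_ k2] := gdd _ (le_lt_trans c2 tN).
have {}k1 := le_trans k1 (ler_wpM2l (ltW e'0) c1).
have {}k2 := le_trans k2 (ler_wpM2l (ltW e'0) c2).
rewrite deriveE// -addrA (addrC (t *: v)).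
move: k1 k2; rewrite linearD [ 'd k p (t *: v)]linearZ /=.
set A := k (p + (_ + _)); set B := k (p + _); set D := 'd k p _; set E := 'd k p v.
move=> k1 k2.
(* The values [k p] and [D] cancel between the two points, leaving [t] times a difference of two
   remainders of the expansion of [k] at [p]. *)
have -> : (A - B) * t - t ^+ 2 * E =
    t * ((A - k p - (D + t * E)) - (B - k p - D)) by ring.
rewrite normrM gtr0_norm// expr2 mulrA [leRHS]mulrC ler_pM2l//.
rewrite (le_trans (ler_normB _ _))// (le_trans (lerD k1 k2))//.
rewrite -mulr2n -mulr_natl.
by rewrite (_ : 2 * _ = t * (2 * (e' * N))); [rewrite (mulrC e) ler_pM2l|ring].
Unshelve. all: by end_near. Qed.

(** The second difference is symmetric in [u] and [v], and each iterated derivative, multiplied by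
    [t ^+ 2], is within [e / 2 * t ^+ 2] of it for small [t]. A single such [t > 0] bounds the gap
    between them by [e]. *)
Lemma derive_sym g p u v :
  (\forall q \near p, differentiable g q) ->
  differentiable ('D_u g) p -> differentiable ('D_v g) p ->
  'D_v ('D_u g) p = 'D_u ('D_v g) p.
Proof.
move=> gd ud vd; apply/eqP; rewrite -subr_eq0 -normr_le0.
apply/ler_addgt0Pr => e e0; rewrite add0r.
have e20 : 0 < e / 2 by rewrite divr_gt0.
have A := @second_difference_approx g p u v gd ud _ e20.
have B := @second_difference_approx g p v u gd vd _ e20.
have [t [[/= {}A {}B] t0]] :=
  @filter_ex _ _ (at_right_proper_filter 0) _ (filterI (filterI A B) (nbhs_right_gt 0)).
rewrite second_differenceC in A.
move: ('D_v ('D_u g) p) ('D_u ('D_v g) p) (second_difference g p v u t) A B.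
move=> L M S A B; rewrite -(@ler_pM2l _ (t ^+ 2)) ?exprn_gt0//.
rewrite -[X in X * `|_|]ger0_norm ?sqr_ge0// -normrM.
have -> : t ^+ 2 * (L - M) = (S - t ^+ 2 * M) - (S - t ^+ 2 * L) by ring.
rewrite (le_trans (ler_normB _ _))// (le_trans (lerD B A))//.
by rewrite -mulrDl -splitr mulrC.
Qed.

End Young.

(** * Octonion multiplication in coordinates and its norm identities *)

Section OctonionProduct.
Context {R : realType}.
Implicit Types x y : 'rV[R]_8.

(* The indices of e_k and of e_k e_4. *)
Definition lo (k : 'I_4) : 'I_8 := @lshift 4 4 k.
Definition hi (k : 'I_4) : 'I_8 := @rshift 4 4 k.

Lemma omulEl x y (k : 'I_4) : omul x y 0 (lo k) =
  (qmul (@lsubmx R 1 4 4 x) (@lsubmx R 1 4 4 y)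
   - qmul (qconj (@rsubmx R 1 4 4 y)) (@rsubmx R 1 4 4 x)) 0 k.
Proof. exact: row_mxEl. Qed.

Lemma omulEr x y (k : 'I_4) : omul x y 0 (hi k) =
  (qmul (@rsubmx R 1 4 4 x) (qconj (@lsubmx R 1 4 4 y))
   + qmul (@rsubmx R 1 4 4 y) (@lsubmx R 1 4 4 x)) 0 k.
Proof. exact: row_mxEr. Qed.

Lemma sum8E (F : 'I_8 -> R) : \sum_m F m =
  F (lo 0) + F (lo 1) + F (lo 2) + F (lo 3)
  + (F (hi 0) + F (hi 1) + F (hi 2) + F (hi 3)).
Proof.
rewrite (@big_split_ord _ _ _ 4 4) /= !big_ord_recl !big_ord0 /= !addr0 !addrA.
do ![congr (_ + _)]; congr F; exact: val_inj.
Qed.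

(** The full multiplication table turns the bilinear identities below into polynomial identities for
    [ring]. The tuple of equations serves as a single rewrite rule. *)
Lemma omul_coords x y :
  (omul x y 0 (lo 0) =
    x 0 (lo 0) * y 0 (lo 0) - x 0 (lo 1) * y 0 (lo 1) - x 0 (lo 2) * y 0 (lo 2)
      - x 0 (lo 3) * y 0 (lo 3) - x 0 (hi 0) * y 0 (hi 0) - x 0 (hi 1) * y 0 (hi 1)
      - x 0 (hi 2) * y 0 (hi 2) - x 0 (hi 3) * y 0 (hi 3)) *
  (omul x y 0 (lo 1) =
    x 0 (lo 0) * y 0 (lo 1) + x 0 (lo 1) * y 0 (lo 0) + x 0 (lo 2) * y 0 (lo 3)
      + x 0 (hi 0) * y 0 (hi 1) + x 0 (hi 3) * y 0 (hi 2) - x 0 (lo 3) * y 0 (lo 2)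
      - x 0 (hi 1) * y 0 (hi 0) - x 0 (hi 2) * y 0 (hi 3)) *
  (omul x y 0 (lo 2) =
    x 0 (lo 0) * y 0 (lo 2) + x 0 (lo 2) * y 0 (lo 0) + x 0 (lo 3) * y 0 (lo 1)
      + x 0 (hi 0) * y 0 (hi 2) + x 0 (hi 1) * y 0 (hi 3) - x 0 (lo 1) * y 0 (lo 3)
      - x 0 (hi 2) * y 0 (hi 0) - x 0 (hi 3) * y 0 (hi 1)) *
  (omul x y 0 (lo 3) =
    x 0 (lo 0) * y 0 (lo 3) + x 0 (lo 3) * y 0 (lo 0) + x 0 (lo 1) * y 0 (lo 2)
      + x 0 (hi 0) * y 0 (hi 3) + x 0 (hi 2) * y 0 (hi 1) - x 0 (lo 2) * y 0 (lo 1)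
      - x 0 (hi 3) * y 0 (hi 0) - x 0 (hi 1) * y 0 (hi 2)) *
  (omul x y 0 (hi 0) =
    x 0 (hi 0) * y 0 (lo 0) + x 0 (hi 1) * y 0 (lo 1) + x 0 (hi 2) * y 0 (lo 2)
      + x 0 (hi 3) * y 0 (lo 3) + x 0 (lo 0) * y 0 (hi 0) - x 0 (lo 1) * y 0 (hi 1)
      - x 0 (lo 2) * y 0 (hi 2) - x 0 (lo 3) * y 0 (hi 3)) *
  (omul x y 0 (hi 1) =
    x 0 (hi 1) * y 0 (lo 0) + x 0 (hi 3) * y 0 (lo 2) + x 0 (lo 1) * y 0 (hi 0)
      + x 0 (lo 0) * y 0 (hi 1) + x 0 (lo 3) * y 0 (hi 2) - x 0 (hi 0) * y 0 (lo 1)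
      - x 0 (hi 2) * y 0 (lo 3) - x 0 (lo 2) * y 0 (hi 3)) *
  (omul x y 0 (hi 2) =
    x 0 (hi 2) * y 0 (lo 0) + x 0 (hi 1) * y 0 (lo 3) + x 0 (lo 2) * y 0 (hi 0)
      + x 0 (lo 0) * y 0 (hi 2) + x 0 (lo 1) * y 0 (hi 3) - x 0 (hi 0) * y 0 (lo 2)
      - x 0 (hi 3) * y 0 (lo 1) - x 0 (lo 3) * y 0 (hi 1)) *
  (omul x y 0 (hi 3) =
    x 0 (hi 3) * y 0 (lo 0) + x 0 (hi 2) * y 0 (lo 1) + x 0 (lo 3) * y 0 (hi 0)
      + x 0 (lo 0) * y 0 (hi 3) + x 0 (lo 2) * y 0 (hi 1) - x 0 (hi 0) * y 0 (lo 3)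
      - x 0 (hi 1) * y 0 (lo 2) - x 0 (lo 1) * y 0 (hi 2)).
Proof. by do !split; rewrite ?omulEl ?omulEr !mxE /=; ring. Qed.

Definition odot x y := \sum_(m < 8) x 0 m * y 0 m.

(** The adjoint of left multiplication by [x] is left multiplication by the conjugate of [x], which
    equals [2 x_0 - x]. *)
Lemma odot_omul_adjoint x y z :
  odot (omul x y) z = 2 * x 0 0 * odot y z - odot y (omul x z).
Proof.
have -> : (0 : 'I_8) = lo 0 by exact: val_inj.
rewrite /odot !sum8E !omul_coords; ring.
Qed.

(** Polarization in both factors; for [x = x'] and [y = y'] this is twice the norm identity. *)
Lemma odot_omul x x' y y' :
  odot (omul x y) (omul x' y') + odot (omul x' y) (omul x y') = 2 * odot x x' * odot y y'.
Proof.
rewrite /odot !sum8E !omul_coords; ring.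
Qed.

Lemma ord4_ind (P : 'I_4 -> Prop) : P 0 -> P 1 -> P 2 -> P 3 -> forall k, P k.
Proof.
move=> P0 P1 P2 P3 [[|[|[|[|//]]]] i4];
  [move: P0|move: P1|move: P2|move: P3]; by congr P; exact: val_inj.
Qed.

Lemma omul1 y : omul (delta_mx 0 0) y = y.
Proof.
apply/rowP => m; rewrite -(@splitK 4 4 m).
set e := delta_mx 0 0.
have e0 : e 0 (lo 0) = 1 by rewrite mxE.
have el k : k != 0 -> e 0 (lo k) = 0 by rewrite mxE; case: k => [[]].
have er k : e 0 (hi k) = 0 by rewrite mxE.
have [e1 e2 e3] : [/\ e 0 (lo 1) = 0, e 0 (lo 2) = 0 & e 0 (lo 3) = 0].
  by split; exact: el.
by case: (fintype.split _) => /=; elim/ord4_ind; rewrite omul_coords e0 e1 e2 e3 !er; ring.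
Qed.

End OctonionProduct.

(** The first order expansion of [g] at [p] is also one of [f], and uniqueness of the differential
    identifies ['d f p] with ['d g p]. *)
Lemma near_eq_differentiable {R : realType} {V W : normedModType R}
    (f g : V -> W) p :
  (\forall q \near p, f q = g q) -> differentiable g p -> differentiable f p.
Proof.
move=> fg dg; have cg := diff_continuous dg.
have fgp : f p = g p := nbhs_singleton fg.
have e : f \o shift p = cst (f p) + 'd g p +o_ 0 id.
  apply/eqaddoP => e e0.
  have /eqaddoP /(_ e e0) := diff_locally dg.
  have : \forall h \near (0 : V), f (h + p) = g (h + p).
    by move: fg; rewrite (near_shift 0) subr0.
  by apply: filterS2 => h fgh; rewrite !fctE /= fgh fgp.
by apply/diff_locallyP; rewrite (diff_unique cg e).
Qed.

(** * Calculus of the operators d_(z_j) on complex-valued functions *)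

Section ComplexDerivatives.
Context {R : realType}.
Local Notation V := 'rV[R]_(8 + 8).
Implicit Types (h : V -> R[i]) (p u v : V) (c : R[i]).

Definition cdiff h p :=
  differentiable (fun q => complex.Re (h q)) p /\
  differentiable (fun q => complex.Im (h q)) p.

Lemma cdiffD h1 h2 p :
  cdiff h1 p -> cdiff h2 p -> cdiff (fun q => h1 q + h2 q) p.
Proof.
move=> [re1 im1] [re2 im2]; split.
  under eq_fun do rewrite raddfD.
  exact: differentiableD.
under eq_fun do rewrite raddfD.
exact: differentiableD.
Qed.

Lemma ReM (a b : R[i]) : complex.Re (a * b) =
  complex.Re a * complex.Re b - complex.Im a * complex.Im b.
Proof. by case: a b => [? ?] [? ?]. Qed.

Lemma ImM (a b : R[i]) : complex.Im (a * b) =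
  complex.Re a * complex.Im b + complex.Im a * complex.Re b.
Proof. by case: a b => [? ?] [? ?]. Qed.

Lemma cdiffZ c h p : cdiff h p -> cdiff (fun q => c * h q) p.
Proof.
move=> [re im]; split.
  under eq_fun do rewrite ReM.
  by apply: differentiableB; exact: differentiableZ.
under eq_fun do rewrite ImM.
by apply: differentiableD; exact: differentiableZ.
Qed.

Lemma cderiveD v h1 h2 p : cdiff h1 p -> cdiff h2 p ->
  cderive v (fun q => h1 q + h2 q) p = cderive v h1 p + cderive v h2 p.
Proof.
move=> [re1 im1] [re2 im2]; rewrite /cderive.
under eq_fun do rewrite raddfD.
under [X in (_ +i* 'D_v X p)%C]eq_fun do rewrite raddfD.
by rewrite !deriveD//; exact: diff_derivable.
Qed.

Lemma cderiveZ v c h p : cdiff h p ->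
  cderive v (fun q => c * h q) p = c * cderive v h p.
Proof.
move=> [re im]; rewrite /cderive.
have vre := @diff_derivable _ _ _ _ _ v re.
have vim := @diff_derivable _ _ _ _ _ v im.
under eq_fun do rewrite ReM.
under [X in (_ +i* 'D_v X p)%C]eq_fun do rewrite ImM.
have /= -> :=
  deriveB (derivableZ (k := complex.Re c) vre) (derivableZ (k := complex.Im c) vim).
have /= -> :=
  deriveD (derivableZ (k := complex.Re c) vim) (derivableZ (k := complex.Im c) vre).
by rewrite !(deriveZ _ vre) !(deriveZ _ vim); case: c.
Qed.

Lemma cderive_near_eq v h1 h2 p : (\forall q \near p, h1 q = h2 q) ->
  cderive v h1 p = cderive v h2 p.
Proof.
move=> h12; rewrite /cderive; congr (_ +i* _)%C;
  by apply: near_eq_derive; apply: filterS h12 => q ->.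
Qed.

Lemma cderive_cst v c p : cderive v (fun=> c) p = 0.
Proof. by rewrite /cderive !derive_cst. Qed.

(** The real symmetry theorem is applied to the real and the imaginary part separately. *)
Lemma cderive_sym u v h p :
  (\forall q \near p, cdiff h q) ->
  cdiff (cderive u h) p -> cdiff (cderive v h) p ->
  cderive v (cderive u h) p = cderive u (cderive v h) p.
Proof.
move=> hd [ure uim] [vre vim].
have hre : \forall q \near p, differentiable (fun r => complex.Re (h r)) q.
  by apply: filterS hd => q [].
have him : \forall q \near p, differentiable (fun r => complex.Im (h r)) q.
  by apply: filterS hd => q [].
exact: (f_equal2 (@Complex R) (derive_sym hre ure vre) (derive_sym him uim vim)).
Qed.

Lemma pdzD j h1 h2 p : cdiff h1 p -> cdiff h2 p ->
  pdz j (fun q => h1 q + h2 q) p = pdz j h1 p + pdz j h2 p.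
Proof. by move=> d1 d2; rewrite /pdz /pdx /pdy !cderiveD// mulrDr addrACA. Qed.

Lemma pdzZ j c h p : cdiff h p -> pdz j (fun q => c * h q) p = c * pdz j h p.
Proof. by move=> d; rewrite /pdz /pdx /pdy !cderiveZ// mulrDr [in RHS]mulrCA. Qed.

(** Derivatives depend only on the germ at [p]; this is what allows an equation valid on an open set
    to be differentiated. *)
Lemma pdz_near_eq j h1 h2 p : (\forall q \near p, h1 q = h2 q) ->
  pdz j h1 p = pdz j h2 p.
Proof. by move=> h12; rewrite /pdz /pdx /pdy !(cderive_near_eq _ h12). Qed.

Lemma pdz_cst j c p : pdz j (fun=> c) p = 0.
Proof. by rewrite /pdz /pdx /pdy !cderive_cst mulr0 addr0. Qed.

Lemma cdiff_cst c p : cdiff (fun=> c) p.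
Proof. by split; exact: differentiable_cst. Qed.

Lemma cdiff_sum (I : Type) (r : seq I) (h : I -> V -> R[i]) p :
  (forall i, cdiff (h i) p) -> cdiff (fun q => \sum_(i <- r) h i q) p.
Proof.
move=> hd; elim: r => [|i r IH].
  by under eq_fun do rewrite big_nil; exact: cdiff_cst.
by under eq_fun do rewrite big_cons; exact: cdiffD.
Qed.

Lemma pdz_sum (I : Type) (r : seq I) j (h : I -> V -> R[i]) p :
  (forall i, cdiff (h i) p) ->
  pdz j (fun q => \sum_(i <- r) h i q) p = \sum_(i <- r) pdz j (h i) p.
Proof.
move=> hd; elim: r => [|i r IH].
  by rewrite big_nil; under eq_fun do rewrite big_nil; exact: pdz_cst.
rewrite big_cons; under eq_fun do rewrite big_cons.
by rewrite pdzD// ?IH//; exact: cdiff_sum.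
Qed.

(** These are the hypotheses of [cderive_sym] at [p], for all directions at once. *)
Definition cdiff2 h p := (\forall q \near p, cdiff h q) /\
  forall v, cdiff (cderive v h) p.

Lemma cdiff_pdz k h p : cdiff2 h p -> cdiff (pdz k h) p.
Proof. by move=> [_ d2]; apply: cdiffD; [exact: d2|apply: cdiffZ; exact: d2]. Qed.

Lemma cderive_pdz v k h p : cdiff2 h p ->
  cderive v (pdz k h) p = cderive v (pdx k h) p + 'i%C * cderive v (pdy k h) p.
Proof.
move=> [_ d2]; have iy : cdiff (fun q => 'i%C * pdy k h q) p.
  by apply: cdiffZ; exact: d2.
by rewrite -(cderiveZ v 'i%C (d2 _)) -(cderiveD v (d2 _) iy).
Qed.

Lemma pdz_pdz j k h p : cdiff2 h p -> pdz j (pdz k h) p =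
  pdx j (pdx k h) p - pdy j (pdy k h) p
    + 'i%C * (pdx j (pdy k h) p + pdy j (pdx k h) p).
Proof.
move=> d; have ii : 'i%C * 'i%C = -1 :> R[i] by rewrite -expr2 sqr_i.
rewrite {1}/pdz [pdx j _ p]cderive_pdz// [pdy j _ p]cderive_pdz//.
rewrite -![cderive (delta_mx 0 (lshift 8 j)) _ _]/(pdx j _ _).
rewrite -![cderive (delta_mx 0 (rshift 8 j)) _ _]/(pdy j _ _).
move: (pdx j (pdx k h) p) (pdx j (pdy k h) p) => A B.
move: (pdy j (pdx k h) p) (pdy j (pdy k h) p) => C D.
(* The product ['i * 'i] is isolated because [ring] does not know its value. *)
transitivity (A + 'i%C * B + 'i%C * C + ('i%C * 'i%C) * D); first by ring.
by rewrite ii; ring.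
Qed.

Lemma pdz_sym j k h p : cdiff2 h p -> pdz j (pdz k h) p = pdz k (pdz j h) p.
Proof.
move=> d; rewrite (pdz_pdz j k d) (pdz_pdz k j d); case: d => d1 d2.
have sym u v : cderive v (cderive u h) p = cderive u (cderive v h) p.
  exact: cderive_sym.
have xx : pdx j (pdx k h) p = pdx k (pdx j h) p := sym _ _.
have yy : pdy j (pdy k h) p = pdy k (pdy j h) p := sym _ _.
(* Exchanging [j] and [k] makes the two mixed terms trade places, so only their sum is preserved. *)
have xy : pdx j (pdy k h) p = pdy k (pdx j h) p := sym _ _.
have yx : pdy j (pdx k h) p = pdx k (pdy j h) p := sym _ _.
have swap (A B C D A' B' C' D' : R[i]) : A = A' -> D = D' -> B = C' -> C = B' ->
    A - D + 'i%C * (B + C) = A' - D' + 'i%C * (B' + C').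
  by move=> -> -> -> ->; rewrite (addrC B').
exact: swap xx yy xy yx.
Qed.

(** On the diagonal the two mixed derivatives coincide, whence the factor 2. *)
Lemma calLE h p : cdiff2 h p ->
  calL h p = lapx h p - lapy h p + 2 * 'i%C * dxdy h p.
Proof.
move=> d; rewrite /calL /lapx /lapy /dxdy mulr_sumr -sumrB -big_split /=.
apply: eq_bigr => j _; rewrite (pdz_pdz j j d); case: d => d1 d2.
have yx : pdy j (pdx j h) p = pdx j (pdy j h) p := cderive_sym d1 (d2 _) (d2 _).
move: yx; move: (pdx j (pdx j h) p) (pdy j (pdy j h) p) (pdx j (pdy j h) p).
by move: (pdy j (pdx j h) p) => A B C D ->; ring.
Qed.

Lemma occomp_Re (f : V -> OC R) k q : complex.Re (occomp f k q) =
  real_form f q 0 (lshift 8 k).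
Proof. by rewrite /real_form /oc_coords row_mxEl mxE. Qed.

Lemma occomp_Im (f : V -> OC R) k q : complex.Im (occomp f k q) =
  real_form f q 0 (rshift 8 k).
Proof. by rewrite /real_form /oc_coords row_mxEr mxE. Qed.

Lemma cdiff_occomp (f : V -> OC R) k p :
  differentiable (real_form f) p -> cdiff (occomp f k) p.
Proof.
move=> d; have dk i := differentiable_comp d (differentiable_coord (real_form f p) 0 i).
split; first by under eq_fun do rewrite occomp_Re; exact: dk.
by under eq_fun do rewrite occomp_Im; exact: dk.
Qed.

(** Vectors are rows, so the Jacobian acts on the right: the derivative is a combination of Jacobian
    entries with constant coefficients [v 0 l]. *)
Lemma derive_coord n (F : V -> 'rV[R]_n) q v i : differentiable F q ->
  'D_v (fun q => F q 0 i) q = (v *m jacobian F q) 0 i.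
Proof.
move=> dF; rewrite -deriveEjacobian// derive_mx ?mxE//.
exact: diff_derivable.
Qed.

Lemma cdiff2_occomp Omega (f : V -> OC R) k p : open Omega ->
  twice_differentiable Omega f -> Omega p -> cdiff2 (occomp f k) p.
Proof.
move=> oO df Op.
have nO : \forall q \near p, Omega q by exact: open_nbhs_nbhs.
split; first by apply: filterS nO => q /df[dq _]; exact: cdiff_occomp.
have dJ v i : differentiable (fun q => 'D_v (fun r => real_form f r 0 i) q) p.
  (* The formula in Jacobian entries is available where [real_form f] is differentiable, hence on a
     neighborhood of [p] inside [Omega]. *)
  apply: (@near_eq_differentiable _ _ _ _
    (\sum_l (fun q => v 0 l *: jacobian (real_form f) q l i))).
    apply: filterS nO => q /df[dq _].
    by rewrite derive_coord// mxE fct_sumE.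
  apply: differentiable_sum => l; apply: differentiableZ.
  exact: (differentiable_comp (df _ Op).2 (differentiable_coord _ l i)).
move=> v; split => /=.
  by under [X in 'D_v X]eq_fun do rewrite occomp_Re.
by under [X in 'D_v X]eq_fun do rewrite occomp_Im.
Qed.

End ComplexDerivatives.

(** * Quadratic relations between the structure constants *)

Section StructureConstants.
Context {R : realType}.
Implicit Types (x y z : 'rV[R]_8) (j k l m n : 'I_8).

Lemma odotC x y : odot x y = odot y x.
Proof. by apply: eq_bigr => m _; rewrite mulrC. Qed.

Lemma odot_delta x m : odot x (delta_mx 0 m) = x 0 m.
Proof.
rewrite /odot (bigD1 m)//= big1 => [|i im]; first by rewrite mxE !eqxx mulr1 addr0.
by rewrite mxE (negPf im) andbF mulr0.
Qed.

Lemma odot_delta2 j k : odot (delta_mx 0 j) (delta_mx 0 k : 'rV[R]_8) = (j == k)%:R.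
Proof. by rewrite odot_delta mxE eqxx eq_sym. Qed.

Definition ocoef j k m : R := omul (delta_mx 0 j) (delta_mx 0 k) 0 m.

Lemma ocoef_adjoint j k m :
  ocoef j k m = 2 * (j == 0)%:R * (k == m)%:R - ocoef j m k.
Proof.
rewrite {1}/ocoef -odot_delta odot_omul_adjoint mxE eqxx [0 == j]eq_sym.
by rewrite odot_delta2 odotC odot_delta.
Qed.

Lemma ocoef0 k m : ocoef 0 k m = (k == m)%:R.
Proof. by rewrite /ocoef omul1 mxE eqxx eq_sym. Qed.

Lemma ocoefC j k m : ocoef j m k = (if j == 0 then 1 else -1) * ocoef j k m.
Proof.
case: eqP => [->|/eqP j0]; first by rewrite mul1r !ocoef0 eq_sym.
by rewrite mulN1r ocoef_adjoint (negPf j0) mulr0 mul0r add0r.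
Qed.

(** This is [odot_omul] on basis vectors. With L_j the matrix of left multiplication by e_j, it is
    the Clifford relation L_j^T L_k + L_k^T L_j = 2 delta_jk. *)
Lemma ocoef_mul j k n l :
  \sum_m ocoef j n m * ocoef k l m + \sum_m ocoef k n m * ocoef j l m =
  2 * (j == k)%:R * (n == l)%:R.
Proof. by rewrite -!odot_delta2 -odot_omul. Qed.

(** By [ocoefC], transposing all constants multiplies both sums by the same sign [e j * e k]. That
    sign is 1 when [j = k], and otherwise the right-hand side is 0. *)
Lemma ocoef_mul_tr j k n l :
  \sum_m ocoef j m n * ocoef k m l + \sum_m ocoef k m n * ocoef j m l =
  2 * (j == k)%:R * (n == l)%:R.
Proof.
pose e j : R := if j == 0 then 1 else -1.
have -> : 2 * (j == k)%:R * (n == l)%:R = e j * e k * (2 * (j == k)%:R * (n == l)%:R).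
  case: (eqVneq j k) => [->|]; last by rewrite !mulr0 !mul0r mulr0.
  by rewrite /e; case: ifP; rewrite ?mulrNN !mul1r.
rewrite -ocoef_mul mulrDr !mulr_sumr; congr (_ + _); apply: eq_bigr => m _;
  by rewrite (ocoefC _ n) (ocoefC _ l) -/(e j) -/(e k); ring.
Qed.

End StructureConstants.

(** Twice the sum, with [j] and [k] exchanged in one copy, pairs [H] with the symmetrized weight,
    which vanishes unless [j = k] and [l = n]. *)
Lemma sum_symmetrized (F : numFieldType) (I : finType) (n : I) (W H : I -> I -> I -> F) :
  (forall j k l, W j k l + W k j l = 2 * (j == k)%:R * (n == l)%:R) ->
  (forall j k l, H j k l = H k j l) ->
  \sum_j \sum_k \sum_l W j k l * H j k l = \sum_j H j j n.
Proof.
move=> W2 Hs; apply: (@mulfI F 2); first by rewrite pnatr_eq0.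
rewrite mulr_natl mulr2n {2}exchange_big -big_split mulr_sumr /=.
apply: eq_bigr => j _; rewrite -big_split /= (bigD1 j)//= [X in _ + X]big1 => [|k kj].
  rewrite addr0 -big_split /= (bigD1 n)//= big1 => [|l ln].
    by rewrite addr0 -mulrDl W2 !eqxx !mulr1.
  by rewrite -mulrDl W2 [n == l]eq_sym (negPf ln) mulr0 mul0r.
rewrite -big_split /= big1// => l _.
by rewrite (Hs k) -mulrDl W2 [j == k]eq_sym (negPf kj) mulr0 !mul0r.
Qed.

(** * Composition of first order operators, and the components of [CR] and [CRbar] *)

Section FirstOrder.
Context {R : realType}.
Local Notation V := 'rV[R]_(8 + 8).
Implicit Types (f : V -> OC R) (p : V) (j k l m n : 'I_8).

(** Both factorizations are instances: [a] holds the coefficients of the outer operator, [b] those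
    of the inner one, and [m] is the intermediate component. *)
Lemma calL_factor (a b : 'I_8 -> 'I_8 -> 'I_8 -> R[i]) f p n :
  (forall k, cdiff2 (occomp f k) p) ->
  (forall j k l, \sum_m a j m n * b k l m + \sum_m a k m n * b j l m =
    2 * (j == k)%:R * (n == l)%:R) ->
  \sum_j \sum_m a j m n *
    pdz j (fun q => \sum_k \sum_l b k l m * pdz k (occomp f l) q) p =
  calL (occomp f n) p.
Proof.
move=> d ab.
pose H j k l := pdz j (pdz k (occomp f l)) p.
have Hsym j k l : H j k l = H k j l by exact: pdz_sym.
have <- : _ = calL (occomp f n) p := sum_symmetrized ab Hsym.
apply: eq_bigr => j _.
transitivity (\sum_m \sum_k \sum_l a j m n * b k l m * H j k l).
  apply: eq_bigr => m _; rewrite pdz_sum => [|k]; last first.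
    by apply: cdiff_sum => l; apply: cdiffZ; exact: cdiff_pdz.
  rewrite mulr_sumr; apply: eq_bigr => k _; rewrite pdz_sum => [|l]; last first.
    by apply: cdiffZ; exact: cdiff_pdz.
  rewrite mulr_sumr; apply: eq_bigr => l _.
  by rewrite -mulrA; congr (_ * _); apply: pdzZ; exact: cdiff_pdz.
(* The sum over [m] moves innermost, where it forms the weight \sum_m a(j,m,n) b(k,l,m). *)
rewrite exchange_big; apply: eq_bigr => k _; rewrite exchange_big.
by apply: eq_bigr => l _; rewrite mulr_suml.
Qed.

Lemma ocmul_oce j (w : OC R) m :
  ocmul (oce R j) w 0 m = \sum_k (ocoef j k m)%:C%C * w 0 k.
Proof.
have ojE i : oce R j 0 i = (i == j)%:R by rewrite mxE eqxx.
rewrite /ocmul summxE (bigD1 j)//= [X in _ + X]big1 => [|i ij]; last first.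
  rewrite summxE big1// => k _.
  by rewrite mxE ojE (negPf ij) !mul0r.
rewrite addr0 summxE; apply: eq_bigr => k _.
by rewrite mxE ojE eqxx mul1r mulrC mxE.
Qed.

Lemma CR_coord f p m :
  CR f p 0 m = \sum_j \sum_k (ocoef j k m)%:C%C * pdz j (occomp f k) p.
Proof.
rewrite /CR summxE; apply: eq_bigr => j _; rewrite ocmul_oce.
by apply: eq_bigr => k _; rewrite mxE.
Qed.

(** The sign of the terms with [j != 0] is absorbed by transposing the constants, while the term
    [j = 0] collapses since e_0 acts as the identity. *)
Lemma CRbar_coord f p m :
  CRbar f p 0 m = \sum_j \sum_k (ocoef j m k)%:C%C * pdz j (occomp f k) p.
Proof.
rewrite /CRbar [LHS]mxE [X in _ + X]mxE summxE [RHS](bigD1 0)//=; congr (_ + _).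
  rewrite mxE (bigD1 m)//= [X in _ + X]big1 => [|k km].
    by rewrite addr0 ocoef0 eqxx mul1r.
  by rewrite ocoef0 eq_sym (negPf km) mul0r.
rewrite -sumrN; apply: eq_bigr => j j0; rewrite ocmul_oce -sumrN.
apply: eq_bigr => k _; rewrite mxE ocoefC (negPf j0).
by rewrite mulN1r rmorphN mulNr opprK.
Qed.

End FirstOrder.

Theorem proposition3p6 (R : realType) (Omega : set 'rV[R]_(8 + 8))
    (f : 'rV[R]_(8 + 8) -> OC R)
    (Omega_open : open Omega) (f_diff2 : twice_differentiable Omega f) :
  (monogenic Omega f ->
     forall (j : 'I_8) p, Omega p -> calL (occomp f j) p = 0) /\
  (forall p, Omega p ->
     [/\ CR (CRbar f) p = \row_(j < 8) calL (occomp f j) p,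
         CRbar (CR f) p = \row_(j < 8) calL (occomp f j) p
       & forall j : 'I_8,
           calL (occomp f j) p =
             lapx (occomp f j) p - lapy (occomp f j) p
               + 2 * 'i%C * dxdy (occomp f j) p]).
Proof.
have d2 p k : Omega p -> cdiff2 (occomp f k) p by exact: cdiff2_occomp.
(* The relations between structure constants are real; this carries their right-hand side into
   [R[i]]. *)
have toC (a b : bool) : (2 * a%:R * b%:R)%:C%C = 2 * a%:R * b%:R :> R[i].
  by rewrite !rmorphM /= !rmorph_nat.
have CRCRbar p : Omega p -> CR (CRbar f) p = \row_j calL (occomp f j) p.
  move=> Op; apply/rowP => n; rewrite mxE CR_coord.
  (* The inner [CRbar] contributes transposed constants, so the relation required is [ocoef_mul_tr];
     in the opposite order it is [ocoef_mul]. *)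
  rewrite -(calL_factor (a := fun j m n => (ocoef j m n)%:C%C)
    (b := fun k l m => (ocoef k m l)%:C%C) (fun k => d2 p k Op)) => [|j k l].
    apply: eq_bigr => j _; apply: eq_bigr => m _; congr (_ * pdz j _ p).
    by rewrite funeqE => q; exact: CRbar_coord.
  rewrite -toC -ocoef_mul_tr rmorphD !rmorph_sum /=; congr (_ + _);
    by apply: eq_bigr => m _; rewrite rmorphM.
have CRbarCR p : Omega p -> CRbar (CR f) p = \row_j calL (occomp f j) p.
  move=> Op; apply/rowP => n; rewrite mxE CRbar_coord.
  rewrite -(calL_factor (a := fun j m n => (ocoef j n m)%:C%C)
    (b := fun k l m => (ocoef k l m)%:C%C) (fun k => d2 p k Op)) => [|j k l].
    apply: eq_bigr => j _; apply: eq_bigr => m _; congr (_ * pdz j _ p).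
    by rewrite funeqE => q; exact: CR_coord.
  rewrite -toC -ocoef_mul rmorphD !rmorph_sum /=; congr (_ + _);
    by apply: eq_bigr => m _; rewrite rmorphM.
split=> [[_ Df0] j p Op|p Op]; last first.
  by split; [exact: CRCRbar|exact: CRbarCR|move=> j; apply: calLE; exact: d2].
(* In this order the inner factor is [CR f], whose components vanish on a neighborhood of [p], so
   their derivatives at [p] are 0. *)
have /rowP /(_ j) := CRbarCR p Op; rewrite mxE => <-.
rewrite CRbar_coord big1// => k _; rewrite big1// => l _.
rewrite (@pdz_near_eq _ _ _ (fun=> 0)) ?pdz_cst ?mulr0//.
have nO : \forall q \near p, Omega q by exact: open_nbhs_nbhs.
by apply: filterS nO => q /Df0; rewrite /occomp => ->; rewrite mxE.
Qed.
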